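(* Let $b:\mathbb{B}^n\to\mathbb{B}^n$ be a holomorphic map and let $\alpha\ge1$ be real. Suppose the kernel $$K^{b,\alpha}(z,w)=\left(\frac{1-\langle b(z),b(w)\rangle}{1-\langle z,w\rangle}\right)^\alpha$$ is positive semidefinite on $\mathbb{B}^n$, and let $H^2_{n,\alpha}(b)$ denote the Hilbert space with reproducing kernel $K^{b,\alpha}$. Then for all $f\in H^2_{n,\alpha}(b)$, the weighted composition operator $M_fC_b$ is bounded on $H^2_{n,\alpha}$ and $$\|M_fC_b\|\le\|f\|_{H^2_{n,\alpha}(b)}.$$ Moreover $C_b$ is bounded on $H^2_{n,\alpha}$ and $$\|C_b\|\le\left(\frac{1+|b(0)|}{1-|b(0)|}\right)^{\alpha/2}.$$
   Context: $\mathbb{B}^n$ is the open unit ball of $\mathbb{C}^n$, $\langle\cdot,\cdot\rangle$ is the standard inner product on $\mathbb{C}^n$ (linear in the first variable), and $|c|=(\sum_{i=1}^n|c_i|^2)^{1/2}$ for $c\in\mathbb{C}^n$. For real $\alpha\ge1$, $H^2_{n,\alpha}$ is the reproducing kernel Hilbert space of functions on $\mathbb{B}^n$ with kernel $$K^\alpha(z,w)=\frac{1}{(1-\langle z,w\rangle)^\alpha}.$$ Powers are taken with the principal branch (for $z,w\in\mathbb{B}^n$ both $1-\langle z,w\rangle$ and $1-\langle b(z),b(w)\rangle$ have positive real part). $C_b$ is the composition operator $(C_bg)(z)=g(b(z))$, and $M_f$ is multiplication by $f$, so $(M_fC_bg)(z)=f(z)g(b(z))$. A kernel $K$ on $\mathbb{B}^n$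 is positive semidefinite if $\sum_{i,j}c_i\overline{c_j}K(w_j,w_i)\ge0$ for all finite sets of points $w_i\in\mathbb{B}^n$ and scalars $c_i\in\mathbb{C}$. *)

(* Defs.v *)
From mathcomp Require Import all_boot all_order all_algebra.
From mathcomp Require Import all_classical all_reals all_analysis.
From mathcomp Require Import complex.

Set Implicit Arguments.
Unset Strict Implicit.
Unset Printing Implicit Defensive.

Import Order.TTheory GRing.Theory Num.Theory.
Import numFieldNormedType.Exports.
Import ComplexField.Normc.

Local Open Scope classical_set_scope.
Local Open Scope ring_scope.

Section ComplexPower.
Context {R : realType}.
Implicit Types z : R[i].

(* Values in ]-pi, pi]; the value at 0 is irrelevant. *)
Definition Carg z : R :=
  let t := acos (complex.Re z / normc z) in
  if 0 <= complex.Im z then t else - t.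

Definition Clog z : R[i] := Complex (ln (normc z)) (Carg z).

Definition Cexp z : R[i] :=
  Complex (expR (complex.Re z) * cos (complex.Im z))
          (expR (complex.Re z) * sin (complex.Im z)).

Definition Cpow z (a : R) : R[i] := Cexp (real_complex R a * Clog z).

End ComplexPower.

Section FunctionSpaces.
Context {R : realType} (X : Type).
Local Notation C := (R[i]).
Implicit Types (f g : X -> C) (K : X -> X -> C).

Definition psd_kernel K : Prop :=
  forall (m : nat) (w : 'I_m -> X) (c : 'I_m -> C),
    0 <= \sum_(i < m) \sum_(j < m) c i * (c j)^*%C * K (w j) (w i).

Definition ip_norm (ip : (X -> C) -> (X -> C) -> C) f : R :=
  Num.sqrt (complex.Re (ip f f)).

(* The inner product is only meaningful on the carrier; its values elsewhere
   are junk. *)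
Record hilbert_fun_space := HilbertFunSpace {
  carrier : set (X -> C);
  ip : (X -> C) -> (X -> C) -> C;
  carrier0 : carrier (fun=> 0);
  carrier_lin : forall a f g, carrier f -> carrier g ->
    carrier (fun x => a * f x + g x);
  ip_linl : forall a f g h, carrier f -> carrier g -> carrier h ->
    ip (fun x => a * f x + g x) h = a * ip f h + ip g h;
  ip_conj : forall f g, carrier f -> carrier g -> ip g f = (ip f g)^*%C;
  ip_ge0 : forall f, carrier f -> 0 <= ip f f;
  ip_def : forall f, carrier f -> ip f f = 0 -> f = (fun=> 0);
  ip_complete : forall u : nat -> X -> C,
    (forall m, carrier (u m)) ->
    (forall e : R, 0 < e -> exists N, forall p q, (N <= p)%N -> (N <= q)%N ->
       ip_norm ip (fun x => u p x - u q x) < e) ->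
    exists2 f, carrier f &
      ip_norm ip (fun x => u m x - f x) @[m --> \oo] --> (0 : R)
}.

Definition hnorm (H : hilbert_fun_space) f : R := ip_norm (ip H) f.

Definition reproducing_kernel (H : hilbert_fun_space) K : Prop :=
  forall w, carrier H (fun z => K z w) /\
    forall f, carrier H f -> f w = ip H f (fun z => K z w).

Definition bounded_op (H : hilbert_fun_space) (T : (X -> C) -> (X -> C)) :=
  (forall g, carrier H g -> carrier H (T g)) /\
  exists M : R, forall g, carrier H g -> hnorm H (T g) <= M * hnorm H g.

Definition opnorm (H : hilbert_fun_space) (T : (X -> C) -> (X -> C)) : R :=
  sup [set hnorm H (T g) | g in [set g | carrier H g /\ hnorm H g <= 1]].

Definition comp_op (b : X -> X) g : X -> C := fun z => g (b z).

Definition mul_op f g : X -> C := fun z => f z * g z.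

End FunctionSpaces.

Section Ball.
Context {R : realType} {n : nat}.
Local Notation C := (R[i]).

Definition cdot (z w : 'rV[C]_n) : C :=
  \sum_(i < n) z ord0 i * (w ord0 i)^*%C.

Definition enorm (z : 'rV[C]_n) : R :=
  Num.sqrt (\sum_(i < n) normc (z ord0 i) ^+ 2).

Lemma enorm0_lt1 : enorm 0 < 1.
Proof.
rewrite /enorm big1 ?sqrtr0 ?ltr01// => i _.
by rewrite mxE normc0 expr0n.
Qed.

End Ball.

Definition Ball (R : realType) (n : nat) : Type :=
  {z : 'rV[R[i]]_n | enorm z < 1}.

Definition ball_origin {R : realType} {n : nat} : Ball R n :=
  exist (fun z : 'rV[R[i]]_n => enorm z < 1) 0 enorm0_lt1.

(* Complex differentiability is tested on an extension of [b] to all of C^n;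
   since the ball is open, the choice of the extension does not matter.  The
   cast to [numFieldType] selects the topology of C and the C-linear notion of
   differential. *)
Definition holomorphic_ball (R : realType) (n : nat) (b : Ball R n -> Ball R n)
    : Prop :=
  let C : numFieldType := R[i] in
  exists2 B : 'rV[C]_n -> 'rV[C]_n,
    (forall z : Ball R n, B (sval z) = sval (b z)) &
    (forall z : Ball R n, differentiable B (sval z : 'rV[C]_n)).

Definition kernel_alpha (R : realType) (n : nat) (alpha : R)
    (z w : Ball R n) : R[i] :=
  1 / Cpow (1 - cdot (sval z) (sval w)) alpha.

Definition kernel_b (R : realType) (n : nat) (b : Ball R n -> Ball R n)
    (alpha : R) (z w : Ball R n) : R[i] :=
  Cpow ((1 - cdot (sval (b z)) (sval (b w))) /
        (1 - cdot (sval z) (sval w))) alpha.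

(* Main.v *)
Require Import Defs.
From mathcomp Require Import all_boot all_order all_algebra.
From mathcomp Require Import all_classical all_reals all_analysis.
From mathcomp Require Import complex ring lra.
Import Order.TTheory GRing.Theory Num.Theory.
Import numFieldNormedType.Exports.
Import ComplexField.Normc.
Set Implicit Arguments.
Unset Strict Implicit.
Unset Printing Implicit Defensive.
Local Open Scope ring_scope.
Local Open Scope classical_set_scope.

(** Write [K] for the kernel of [H], [Kb] for the kernel of the hypothesis, and
    [K (b, b)] for the kernel [K (b z) (b w)]. For points of the ball the numbers
    [1 - <z, w>] have positive real part, so principal powers respect quotients
    and [K = Kb * K (b, b)].

    An operator [g |-> f * (g \o b)] has norm at most [c] on [H] as soon as
    [c^2 K z w - f z * conj (f w) * K (b z) (b w)] is a positive semidefinite kernel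
    ([twist_bounded], [weighted_composition_bounded]): this says that its adjoint, which sends the
    kernel function at [w] to [conj (f w)] times the one at [b w], is bounded by
    [c] on the span of the kernel functions, and a Riesz representation argument
    ([carrier_of_bounded_functional]) then shows that [f * (g \o b)] belongs to
    [H]. If [f] lies in the space of [Kb], then [|f|^2 Kb z w - f z * conj (f w)] is
    positive semidefinite, and multiplying it by [K (b, b)] with the help of
    Schur's product theorem [psdM] gives the required positivity with [c = |f|].

    For the composition operator itself, put [a = b 0], [r = |a|] and
    [phi z = <b z, a>]. The previous argument applies to the kernel function of
    [Kb] at the origin, [(1 - phi) ^ alpha], whose squared norm is
    [(1 - r^2) ^ alpha]. It remains to divide by this function, that is, to bound
    the multiplier [(1 - phi) ^ (- alpha)] by [(1 - r) ^ (- alpha)]; the product of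
    the two bounds is [((1 + r) / (1 - r)) ^ (alpha / 2)]. Since [alpha >= 1], the
    kernel [(1 - <b z, b w>) K z w], the product of [Kb] and
    [(1 - <b z, b w>) ^ (1 - alpha)], is positive semidefinite
    ([psd_row_contraction]). So [b] is a row contraction and [phi] a multiplier of
    norm at most [r].

    Both uses of negative powers, for kernels and for multipliers with norm
    bounds, are instances of one statement ([semiring_negative_power]): a class of
    complex functions which contains the nonnegative constants and is closed under
    sums, products and pointwise limits contains [(1 - u) ^ (- s)], for [s >= 0],
    together with each of its members [u] of modulus less than [1]. Taking square
    roots of [1 - u] by a fixed point iteration with nonnegative coefficients
    gives the dyadic exponents, and the other ones follow by continuity. *)

(** * Complex numbers and limits of complex sequences *)

Section ComplexNumbers.
Context {R : realType}.
Local Notation C := (R[i]).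
Implicit Types (z w : C) (r : R).

Lemma ReD z w : complex.Re (z + w) = complex.Re z + complex.Re w.
Proof. by case: z w => [a b] [c d]. Qed.

Lemma ImD z w : complex.Im (z + w) = complex.Im z + complex.Im w.
Proof. by case: z w => [a b] [c d]. Qed.

Lemma ReN z : complex.Re (- z) = - complex.Re z.
Proof. by case: z. Qed.

Lemma ImN z : complex.Im (- z) = - complex.Im z.
Proof. by case: z. Qed.

Lemma ReM z w : complex.Re (z * w) =
  complex.Re z * complex.Re w - complex.Im z * complex.Im w.
Proof. by case: z w => [a b] [c d]. Qed.

Lemma ImM z w : complex.Im (z * w) =
  complex.Re z * complex.Im w + complex.Im z * complex.Re w.
Proof. by case: z w => [a b] [c d]. Qed.

Lemma ReJ z : complex.Re (z^*)%C = complex.Re z.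
Proof. by case: z. Qed.

Lemma ImJ z : complex.Im (z^*)%C = - complex.Im z.
Proof. by case: z. Qed.

Lemma complex_eqP z w : complex.Re z = complex.Re w ->
  complex.Im z = complex.Im w -> z = w.
Proof. by case: z w => [a b] [c d] /= -> ->. Qed.

Lemma conj_ge0_id z : 0 <= z -> (z^*)%C = z.
Proof. by rewrite lecE /=; case: z => a b /= /andP[/eqP -> _]; rewrite oppr0. Qed.

Lemma ge0_realE z : 0 <= z -> z = (complex.Re z)%:C%C.
Proof. by rewrite lecE /=; case: z => a b /= /andP[/eqP -> _]. Qed.

Lemma Re_ge0 z : 0 <= z -> 0 <= complex.Re z.
Proof. by rewrite lecE => /andP[]. Qed.

Lemma normc_ge0 z : 0 <= normc z.
Proof. by case: z => a b; exact: sqrtr_ge0. Qed.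

Lemma sqr_normcE z : normc z ^+ 2 = complex.Re z ^+ 2 + complex.Im z ^+ 2.
Proof. by case: z => a b /=; rewrite sqr_sqrtr ?addr_ge0 ?sqr_ge0. Qed.

Lemma mul_conjE z : z * (z^*)%C = (normc z ^+ 2)%:C%C.
Proof.
by rewrite sqr_normcE; case: z => a b; apply: complex_eqP => /=; ring.
Qed.

Lemma normcJE z : normc (z^*)%C = normc z.
Proof. by case: z => a b /=; rewrite sqrrN. Qed.

Lemma normc_realE r : 0 <= r -> normc r%:C%C = r.
Proof. by move=> r0; rewrite /= expr0n addr0 sqrtr_sqr ger0_norm. Qed.

Lemma normc_gt0 z : z != 0 -> 0 < normc z.
Proof.
move=> z0; rewrite lt_neqAle normc_ge0 andbT eq_sym.
by apply: contra z0 => /eqP/eq0_normc ->.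
Qed.

Lemma Re_le_normc z : `|complex.Re z| <= normc z.
Proof.
by case: z => a b /=; rewrite -sqrtr_sqr ler_wsqrtr// lerDl sqr_ge0.
Qed.

Lemma Im_le_normc z : `|complex.Im z| <= normc z.
Proof.
by case: z => a b /=; rewrite -sqrtr_sqr ler_wsqrtr// lerDr sqr_ge0.
Qed.

Lemma normcX z k : normc (z ^+ k) = normc z ^+ k.
Proof. by elim: k => [|k IH]; rewrite ?normc1// !exprS normcM IH. Qed.

Lemma Re_1B_gt0 z : normc z < 1 -> 0 < complex.Re (1 - z).
Proof.
move=> z1; rewrite ReD ReN subr_gt0 (le_lt_trans (ler_norm _))//.
exact: le_lt_trans (Re_le_normc z) z1.
Qed.

Lemma Re_gt0_neq0 z : 0 < complex.Re z -> z != 0.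
Proof. by apply: contraTneq => ->; rewrite ltxx. Qed.

(** Convergence of complex sequences is handled through real and imaginary
    parts, so that the algebra of limits is that of real sequences. *)
Definition ccvg (u : nat -> C) (l : C) : Prop :=
  (complex.Re (u k) @[k --> \oo] --> complex.Re l) /\
  (complex.Im (u k) @[k --> \oo] --> complex.Im l).

Lemma ccvg_cst z : ccvg (fun=> z) z.
Proof. by split; exact: cvg_cst. Qed.

Lemma ccvgD u v z w : ccvg u z -> ccvg v w -> ccvg (fun k => u k + v k) (z + w).
Proof.
move=> [uz uz'] [vw vw']; split.
  by rewrite ReD; under eq_fun do rewrite ReD; exact: cvgD.
by rewrite ImD; under eq_fun do rewrite ImD; exact: cvgD.
Qed.

Lemma ccvgM u v z w : ccvg u z -> ccvg v w -> ccvg (fun k => u k * v k) (z * w).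
Proof.
move=> [uz uz'] [vw vw']; split.
  rewrite ReM; under eq_fun do rewrite ReM.
  by apply: cvgB; exact: cvgM.
rewrite ImM; under eq_fun do rewrite ImM.
by apply: cvgD; exact: cvgM.
Qed.

Lemma ccvgJ u z : ccvg u z -> ccvg (fun k => (u k)^*%C) (z^*)%C.
Proof.
move=> [uz uz']; split.
  by rewrite ReJ; under eq_fun do rewrite ReJ.
by rewrite ImJ; under eq_fun do rewrite ImJ; exact: cvgN.
Qed.

Lemma ccvgB u v z w : ccvg u z -> ccvg v w -> ccvg (fun k => u k - v k) (z - w).
Proof.
move=> uz vw; have := ccvgD uz (ccvgM (ccvg_cst (-1)) vw).
by rewrite mulN1r; under eq_fun do rewrite mulN1r.
Qed.

Lemma ccvg_sum (T : Type) (s : seq T) (u : T -> nat -> C) (l : T -> C) :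
  (forall x, ccvg (u x) (l x)) ->
  ccvg (fun k => \sum_(x <- s) u x k) (\sum_(x <- s) l x).
Proof.
move=> ul; elim: s => [|x s IH].
  rewrite big_nil; under eq_fun do rewrite big_nil.
  exact: ccvg_cst.
rewrite big_cons; under eq_fun do rewrite big_cons.
exact: ccvgD.
Qed.

Lemma ccvg_ge0 u z : (forall k, 0 <= u k) -> ccvg u z -> 0 <= z.
Proof.
move=> u0 [uz uz']; rewrite lecE; apply/andP; split.
  have im0 : (fun k => complex.Im (u k)) = cst 0.
    by apply/funext => k; move: (u0 k); rewrite lecE => /andP[/eqP -> _].
  move: uz'; rewrite im0 => uz'.
  apply/eqP; apply: (cvg_unique _ uz' (cvg_cst _)); exact: Rhausdorff.
apply: (cvgr_to_ge uz); near=> k.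
exact: Re_ge0.
Unshelve. all: by end_near. Qed.

Lemma ccvg_dist u z : normc (u k - z) @[k --> \oo] --> (0 : R) -> ccvg u z.
Proof.
move=> uz; split; apply/subr_cvg0/norm_cvg0P => /=.
  apply: (@squeeze_cvgr _ _ _ _ (cst 0) (fun k => normc (u k - z)) _) => //.
    near=> k; rewrite normr_ge0/=; move: (Re_le_normc (u k - z)).
    by rewrite ReD ReN.
  exact: cvg_cst.
apply: (@squeeze_cvgr _ _ _ _ (cst 0) (fun k => normc (u k - z)) _) => //.
  near=> k; rewrite normr_ge0/=; move: (Im_le_normc (u k - z)).
  by rewrite ImD ImN.
exact: cvg_cst.
Unshelve. all: by end_near. Qed.

Lemma ccvg_unique u z w : ccvg u z -> ccvg u w -> z = w.
Proof.
move=> [uz uz'] [uw uw'].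
by apply: complex_eqP; [apply: cvg_unique uz uw | apply: cvg_unique uz' uw'];
  exact: Rhausdorff.
Qed.

Lemma ccvg_geometric u z (c r : R) : 0 <= r < 1 ->
  (forall k, normc (u k - z) <= c * r ^+ k) -> ccvg u z.
Proof.
move=> /andP[r0 r1] ucr; apply: ccvg_dist.
apply: (@squeeze_cvgr _ _ _ _ (cst 0) (fun k => c * r ^+ k) _).
- by near=> k; rewrite normc_ge0 ucr.
- exact: cvg_cst.
- rewrite -[X in _ --> X](mulr0 c); apply: cvgMr.
  by apply: cvg_expr; rewrite ger0_norm.
Unshelve. all: by end_near. Qed.

End ComplexNumbers.

(** * Principal powers *)

Section PrincipalPowers.
Context {R : realType}.
Local Notation C := (R[i]).
Implicit Types (z w : C) (a b : R).

Lemma CexpD z w : Cexp (z + w) = Cexp z * Cexp w.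
Proof.
case: z w => [a b] [c d]; apply: complex_eqP => /=;
  rewrite expRD ?cosD ?sinD; ring.
Qed.

Lemma Cexp0 : Cexp (0 : C) = 1.
Proof. by apply: complex_eqP => /=; rewrite expR0 ?cos0 ?sin0 ?mulr1 ?mulr0. Qed.

Lemma CexpN z : Cexp (- z) = (Cexp z)^-1.
Proof.
by apply/esym/mulr1_eq; rewrite -CexpD subrr Cexp0.
Qed.

Lemma normc_Cexp z : normc (Cexp z) = expR (complex.Re z).
Proof.
case: z => a b /=; rewrite !exprMn -mulrDr cos2Dsin2 mulr1 sqrtr_sqr.
by rewrite ger0_norm ?expR_ge0.
Qed.

Lemma Carg_trig z : z != 0 ->
  [/\ cos (Carg z) = complex.Re z / normc z,
      sin (Carg z) = complex.Im z / normc z & `|Carg z| <= pi].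
Proof.
move=> z0; have nz := normc_gt0 z0.
have c1 : -1 <= complex.Re z / normc z <= 1.
  rewrite -ler_norml normrM [X in _ * X]ger0_norm ?invr_ge0 ?normc_ge0//.
  by rewrite ler_pdivrMr ?mul1r// Re_le_normc.
have s1 : sin (acos (complex.Re z / normc z)) = `|complex.Im z| / normc z.
  rewrite sin_acos//.
  have -> : 1 - (complex.Re z / normc z) ^+ 2 = (complex.Im z / normc z) ^+ 2.
    have nz0 : normc z != 0 by rewrite gt_eqF.
    have -> : 1 - (complex.Re z / normc z) ^+ 2 =
        (normc z ^+ 2 - complex.Re z ^+ 2) / normc z ^+ 2 by field.
    by rewrite {1}sqr_normcE addrAC subrr add0r -expr_div_n.
  by rewrite sqrtr_sqr normrM [X in _ * X]ger0_norm// invr_ge0 ltW.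
have p0 : 0 <= acos (complex.Re z / normc z) by rewrite acos_ge0.
have p1 : acos (complex.Re z / normc z) <= pi by rewrite acos_lepi.
rewrite /Carg; case: ifPn => im.
  by split; [rewrite acosK ?in_itv | rewrite s1 ger0_norm| rewrite ger0_norm].
rewrite -ltNge in im.
split; [by rewrite cosN acosK ?in_itv| |by rewrite normrN ger0_norm].
by rewrite sinN s1 ltr0_norm// mulNr opprK.
Qed.

Lemma ClogK z : z != 0 -> Cexp (Clog z) = z.
Proof.
move=> z0; have nz := normc_gt0 z0; have [c s _] := Carg_trig z0.
by apply: complex_eqP; rewrite /= lnK ?posrE// ?c ?s mulrC divfK// gt_eqF.
Qed.

(** The strip [|Im z| < pi] is where the logarithm inverts the exponential. The
    rules for powers of quotients and of powers hold where the logarithms involved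
    stay in it. *)
Lemma CexpK z : `|complex.Im z| < pi -> Clog (Cexp z) = z.
Proof.
move=> zpi; have e0 : 0 < expR (complex.Re z) := expR_gt0 _.
apply: complex_eqP => /=.
  by have := normc_Cexp z => /= ->; rewrite expRK.
have := normc_Cexp z; rewrite /Carg /= => -> /=.
rewrite pmulr_rge0// mulrAC divff ?gt_eqF// mul1r.
case: (leP 0 (complex.Im z)) => im.
  rewrite sin_ge0_pi ?cosK ?in_itv/=.
  - by [].
  - by rewrite im/= ltW// -(ger0_norm im).
  - by rewrite im/= ltW// -(ger0_norm im).
have im' : 0 < - complex.Im z by rewrite oppr_gt0.
rewrite ltr0_norm// in zpi.
have sn : sin (complex.Im z) < 0.
  by rewrite -oppr_gt0 -sinN sin_gt0_pi// im'.
rewrite leNgt sn/= -cosN cosK ?opprK// in_itv/=.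
by rewrite !ltW.
Qed.

Lemma normr_Carg_lt z : 0 < complex.Re z -> `|Carg z| < pi / 2.
Proof.
move=> rz; have z0 := Re_gt0_neq0 rz; have [c s p] := Carg_trig z0.
rewrite ltNge; apply/negP => q.
have : 0 < cos `|Carg z|.
  have -> : cos `|Carg z| = cos (Carg z).
    by case: (leP 0 (Carg z)) => h; [rewrite ger0_norm | rewrite ltr0_norm// cosN].
  by rewrite c divr_gt0// normc_gt0.
have pi2 : 0 <= (pi : R) / 2 <= pi.
  by rewrite divr_ge0 ?pi_ge0//= ler_pdivrMr// ler_peMr ?pi_ge0// ler1n.
by rewrite -cos_pihalf ltr_cos ?in_itv//= ?normr_ge0// ltNge q.
Qed.

Lemma Cpow_neq0 z a : Cpow z a != 0.
Proof.
apply/negP => /eqP h; have := normc_Cexp (real_complex R a * Clog z).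
by rewrite -/(Cpow z a) h normc0 => /esym/eqP; rewrite gt_eqF ?expR_gt0.
Qed.

Lemma CpowD z a b : Cpow z (a + b) = Cpow z a * Cpow z b.
Proof. by rewrite /Cpow rmorphD mulrDl CexpD. Qed.

Lemma Cpow0 z : Cpow z 0 = 1.
Proof. by rewrite /Cpow rmorph0 mul0r Cexp0. Qed.

Lemma CpowN z a : Cpow z (- a) = (Cpow z a)^-1.
Proof. by rewrite /Cpow rmorphN mulNr CexpN. Qed.

Lemma Cpow1 z : z != 0 -> Cpow z 1 = z.
Proof. by move=> z0; rewrite /Cpow rmorph1 mul1r ClogK. Qed.

Lemma CpowMn z a k : Cpow z (a *+ k) = Cpow z a ^+ k.
Proof. by elim: k => [|k IH]; rewrite ?Cpow0// mulrS CpowD IH exprS. Qed.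

(** On the right half plane the arguments lie in [(-pi/2, pi/2)], so their
    difference is the argument of the quotient. *)
Lemma Cpow_div z w a : 0 < complex.Re z -> 0 < complex.Re w ->
  Cpow (z / w) a = Cpow z a / Cpow w a.
Proof.
move=> rz rw; have z0 := Re_gt0_neq0 rz; have w0 := Re_gt0_neq0 rw.
rewrite /Cpow -CexpN -CexpD -mulrBr; congr (Cexp (_ * _)).
rewrite -[in LHS](ClogK z0) -[in LHS](ClogK w0) -CexpN -CexpD CexpK//.
rewrite ImD ImN /= (le_lt_trans (ler_normB _ _))//.
by rewrite [ltRHS]splitr ltrD// normr_Carg_lt.
Qed.

Lemma Im_scale_Clog z a : complex.Im (real_complex R a * Clog z) = a * Carg z.
Proof. by rewrite ImM /= mul0r addr0. Qed.

Lemma scale_Carg_lt z a : 0 < complex.Re z -> `|a| <= 1 ->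
  `|complex.Im (real_complex R a * Clog z)| < pi / 2.
Proof.
move=> rz a1; rewrite Im_scale_Clog normrM.
by rewrite (le_lt_trans _ (normr_Carg_lt rz))// ler_piMl.
Qed.

Lemma Cpow_Cpow z a b : 0 < complex.Re z -> `|a| <= 1 ->
  Cpow (Cpow z a) b = Cpow z (b * a).
Proof.
move=> rz a1; rewrite /Cpow rmorphM -mulrA CexpK//.
rewrite (lt_le_trans (scale_Carg_lt rz a1))//.
by rewrite ler_pdivrMr// ler_peMr ?pi_ge0// ler1n.
Qed.

Lemma Re_Cpow_gt0 z a : 0 < complex.Re z -> `|a| <= 1 -> 0 < complex.Re (Cpow z a).
Proof.
move=> rz a1; have := scale_Carg_lt rz a1.
by rewrite ltr_norml /Cpow /Cexp /= => h; rewrite mulr_gt0 ?expR_gt0// cos_gt0_pihalf.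
Qed.

Lemma Cpow_real (x a : R) : 0 < x -> Cpow x%:C%C a = (x `^ a)%:C%C.
Proof.
move=> x0; rewrite /Cpow /Clog /Carg lexx normc_realE ?ltW//= divff ?gt_eqF//.
rewrite acos1 /powR (gt_eqF x0).
apply: complex_eqP => /=;
  by rewrite !(mul0r, mulr0, subr0, addr0, cos0, sin0, mulr1).
Qed.

Lemma ccvg_Cpow z (u : nat -> R) a : u @ \oo --> a ->
  ccvg (fun k => Cpow z (u k)) (Cpow z a).
Proof.
move=> ua; have uc (c : R) : u k * c @[k --> \oo] --> a * c.
  by apply: cvgM => //; exact: cvg_cst.
split; rewrite /Cpow /Cexp /=.
  under eq_fun do rewrite !mul0r subr0 addr0.
  rewrite !mul0r subr0 addr0; apply: cvgM.
    by apply: continuous_cvg (uc _); exact: continuous_expR.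
  by apply: continuous_cvg (uc _); exact: continuous_cos.
under eq_fun do rewrite !mul0r subr0 addr0.
rewrite !mul0r subr0 addr0; apply: cvgM.
  by apply: continuous_cvg (uc _); exact: continuous_expR.
by apply: continuous_cvg (uc _); exact: continuous_sin.
Qed.

End PrincipalPowers.

(** * Negative powers in classes of functions closed under limits *)

Section LimitSemiring.
Context {R : realType} (I : Type).
Local Notation C := (R[i]).

(** The properties that the functional calculus [u |-> (1 - u) ^ (- a)] uses. They
    are shared by the positive semidefinite kernels, with [I] the pairs of
    points, and by the multipliers of a Hilbert space with bounds for their
    norms. *)
Record limit_semiring (Q : (I -> C) -> Prop) : Prop := LimitSemiring {
  semiring_cst : forall r : R, 0 <= r -> Q (fun=> r%:C%C);
  semiring_add : forall u v, Q u -> Q v -> Q (fun x => u x + v x);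
  semiring_mul : forall u v, Q u -> Q v -> Q (fun x => u x * v x);
  semiring_lim : forall (v : nat -> I -> C) u, (forall k, Q (v k)) ->
    (forall x, ccvg (fun k => v k x) (u x)) -> Q u
}.

Variable Q : (I -> C) -> Prop.
Hypothesis QS : limit_semiring Q.
Implicit Types u v : I -> C.

Lemma semiring_exp u k : Q u -> Q (fun x => u x ^+ k).
Proof.
move=> Qu; elim: k => [|k IH].
  by have := semiring_cst QS ler01; under [X in Q X -> _]eq_fun do rewrite rmorph1.
under eq_fun do rewrite exprS.
exact: (semiring_mul QS).
Qed.

Lemma semiring_inv1B u : Q u -> (forall x, normc (u x) < 1) ->
  Q (fun x => (1 - u x)^-1).
Proof.
move=> Qu u1; apply: (semiring_lim QS (v := fun k x => \sum_(j < k) u x ^+ j)).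
  elim=> [|k IH].
    have := semiring_cst QS (lexx 0); congr Q; apply/funext => x.
    by rewrite big_ord0.
  under eq_fun do rewrite big_ord_recr /=.
  by apply: (semiring_add QS) => //; exact: semiring_exp.
move=> x; have x0 : 1 - u x != 0 := Re_gt0_neq0 (Re_1B_gt0 (u1 x)).
apply: (@ccvg_geometric _ _ _ (normc (1 - u x)^-1) (normc (u x))).
  by rewrite normc_ge0 u1.
move=> k; rewrite -normcX -normcM -[leLHS]normcN.
suff -> : - (\sum_(j < k) u x ^+ j - (1 - u x)^-1) = (1 - u x)^-1 * u x ^+ k by [].
apply: (mulfI x0); rewrite mulrA mulfV// mul1r mulrN mulrBr mulfV//.
have -> : (1 - u x) * (\sum_(j < k) u x ^+ j) = 1 - u x ^+ k.
  by rewrite -(opprB (u x)) mulNr -subrX1 opprB.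
by ring.
Qed.

Lemma sqr_Cpow_half (z : C) : z != 0 -> Cpow z 2^-1 ^+ 2 = z.
Proof. by move=> z0; rewrite -CpowMn -[_ *+ 2]mulr_natr mulVf ?pnatr_eq0// Cpow1. Qed.

Lemma normc_1B_sqrt (z : C) : normc z < 1 ->
  normc (1 - Cpow (1 - z) 2^-1) <= normc z.
Proof.
move=> z1; have rz := Re_1B_gt0 z1; set p := Cpow _ _.
have p0 : 0 < complex.Re p.
  by rewrite Re_Cpow_gt0// ger0_norm ?invf_le1 ?ler1n ?ltr0n// invr_ge0.
have pz : (1 + p) * (1 - p) = z.
  have := sqr_Cpow_half (Re_gt0_neq0 rz); rewrite -/p => h.
  have -> : (1 + p) * (1 - p) = 1 - p ^+ 2 by ring.
  by rewrite h; ring.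
rewrite -[in leRHS]pz normcM ler_peMl ?normc_ge0//.
apply: le_trans (Re_le_normc _); apply: le_trans (ler_norm _).
by rewrite ReD /= lerDl ltW.
Qed.

(** The function [y = 1 - sqrt (1 - u)] is the fixed point of
    [y |-> (u + y ^ 2) / 2], a polynomial with nonnegative coefficients. All the
    iterates started at [0] lie in the disc of radius [|u|] where this map
    contracts by [|u|]. *)
Lemma semiring_1B_sqrt u : Q u -> (forall x, normc (u x) < 1) ->
  Q (fun x => 1 - Cpow (1 - u x) 2^-1).
Proof.
move=> Qu u1.
pose step (z y : C) : C := (2^-1)%:C%C * (z + y ^+ 2).
have normc_half : normc ((2^-1)%:C%C : C) = 2^-1.
  by rewrite normc_realE// invr_ge0.
apply: (semiring_lim QS (v := fun k x => iter k (step (u x)) 0)).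
  elim=> [|k IH]; first exact: (semiring_cst QS (lexx 0)).
  rewrite [X in Q X](_ : _ = fun x => (2^-1)%:C%C *
      (u x + iter k (step (u x)) 0 ^+ 2)) //.
  apply: (semiring_mul QS); first by apply: (semiring_cst QS); rewrite invr_ge0.
  by apply: (semiring_add QS) => //; exact: semiring_exp.
move=> x; set y := 1 - _; set r := normc (u x).
have r0 : 0 <= r := normc_ge0 _.
have yr : normc y <= r by exact: normc_1B_sqrt.
have fixy : y = step (u x) y.
  have := sqr_Cpow_half (Re_gt0_neq0 (Re_1B_gt0 (u1 x))).
  rewrite /step /y; set p := Cpow _ _ => h.
  have -> : u x + (1 - p) ^+ 2 = 2 * (1 - p).
    by rewrite sqrrB h; ring.
  by rewrite mulrA fmorphV rmorph_nat mulVf ?mul1r// pnatr_eq0.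
have iter_le k : normc (iter k (step (u x)) 0) <= r.
  elim: k => [|k IH]; first by rewrite normc0.
  rewrite iterS /step normcM normc_half ler_pdivrMl//.
  apply: (le_trans (le_normcD _ _)); rewrite normcX mulr2n mulrDl mul1r lerD2l.
  apply: le_trans (_ : r ^+ 2 <= _); first by rewrite ler_pXn2r ?nnegrE ?normc_ge0.
  by rewrite expr2 ler_piMl// ltW// u1.
apply: (@ccvg_geometric _ _ _ r r); first by rewrite r0 u1.
elim=> [|k IH]; first by rewrite expr0 mulr1 sub0r normcN.
rewrite iterS [X in _ - X]fixy.
set w := iter k _ _ in IH *.
have -> : step (u x) w - step (u x) y = (2^-1)%:C%C * (w + y) * (w - y).
  by rewrite /step; ring.
rewrite exprSr mulrA normcM mulrC ler_pM ?normc_ge0// normcM normc_half.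
rewrite ler_pdivrMl// mulr2n mulrDl mul1r (le_trans (le_normcD _ _))//.
by rewrite lerD// iter_le.
Qed.

(** The bound by [1] is part of the conclusion so that the square root step
    can be repeated. *)
Lemma semiring_1B_dyadic_root u k : Q u -> (forall x, normc (u x) < 1) ->
  Q (fun x => 1 - Cpow (1 - u x) (2^-1 ^+ k)) /\
  (forall x, normc (1 - Cpow (1 - u x) (2^-1 ^+ k)) < 1).
Proof.
move=> Qu u1; elim: k => [|k [IHQ IH1]].
  have e x : 1 - Cpow (1 - u x) 1 = u x.
    rewrite Cpow1; first by ring.
    exact/Re_gt0_neq0/Re_1B_gt0.
  by rewrite expr0; split=> [|x]; [under eq_fun do rewrite e | rewrite e].
have e x : 1 - Cpow (1 - u x) (2^-1 ^+ k.+1) =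
    1 - Cpow (1 - (1 - Cpow (1 - u x) (2^-1 ^+ k))) 2^-1.
  have -> (c : C) : 1 - (1 - c) = c by ring.
  rewrite Cpow_Cpow -?exprS//; first exact: Re_1B_gt0.
  by rewrite ger0_norm ?exprn_ge0 ?exprn_ile1 ?invr_ge0 ?invf_le1 ?ler1n.
split=> [|x]; first by under eq_fun do rewrite e; exact: semiring_1B_sqrt.
by rewrite e (le_lt_trans (normc_1B_sqrt _)).
Qed.

(** With [y = 1 - (1 - u) ^ (1 / 2 ^ k)] one has
    [(1 - u) ^ (- m / 2 ^ k) = (1 / (1 - y)) ^ m], a product of geometric series in
    [y]; every exponent is a limit of dyadic ones. *)
Theorem semiring_negative_power u (a : R) : Q u -> (forall x, normc (u x) < 1) ->
  0 <= a -> Q (fun x => Cpow (1 - u x) (- a)).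
Proof.
move=> Qu u1 a0.
pose m k := Num.truncn (a * 2 ^+ k).
pose d k : R := - ((2^-1 ^+ k) *+ m k).
apply: (semiring_lim QS (v := fun k x => Cpow (1 - u x) (d k))) => [k|x].
  have [Qk uk] := semiring_1B_dyadic_root k Qu u1.
  have := semiring_exp (m k) (semiring_inv1B Qk uk).
  congr Q; apply/funext => x.
  have -> (c : C) : 1 - (1 - c) = c by ring.
  by rewrite /d CpowN CpowMn (exprVn (Cpow _ _)).
apply: ccvg_Cpow; rewrite /d; apply: cvgN.
apply/subr_cvg0/norm_cvg0P => /=.
apply: (@squeeze_cvgr _ _ _ _ (cst 0) (fun k => (2^-1 : R) ^+ k) _).
- near=> k; rewrite normr_ge0/= distrC.
  have p0 : 0 < (2 : R) ^+ k by rewrite exprn_gt0.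
  have /andP[l g] := truncn_itv (mulr_ge0 a0 (ltW p0)).
  rewrite -mulr_natr exprVn ger0_norm; last first.
    by rewrite subr_ge0 ler_pdivrMl// mulrC.
  rewrite lerBlDr -{1}[(2 ^+ k)^-1]mulr1 -mulrDr ler_pdivlMl// mulrC addrC.
  by rewrite natr1 ltW.
- exact: cvg_cst.
- by apply: cvg_expr; rewrite ger0_norm ?invr_ge0// invf_lt1 ?ltr1n.
Unshelve. all: by end_near. Qed.

End LimitSemiring.

(** * Positive semidefinite kernels *)

Section PositiveKernels.
Context {R : realType} (X : Type).
Local Notation C := (R[i]).
Implicit Types (K L M : X -> X -> C) (s t : seq (C * X)).

(** A formal combination [s] of points stands for [\sum_(x <- s) x.1 * L _ x.2];
    [form L] is the inner product of such sums. *)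
Definition form L s t : C :=
  \sum_(x <- s) \sum_(y <- t) x.1 * (y.1)^*%C * L y.2 x.2.

Definition psd L : Prop := forall s, 0 <= form L s s.

Lemma psd_kernel_psd L : psd_kernel L -> psd L.
Proof.
move=> Lpsd s; rewrite /form big_tnth; under eq_bigr do rewrite big_tnth.
exact: (Lpsd (size s) (fun i => (tnth (in_tuple s) i).2)
  (fun i => (tnth (in_tuple s) i).1)).
Qed.

Lemma eq_form L M s t : (forall z w, L z w = M z w) -> form L s t = form M s t.
Proof.
by move=> LM; apply: eq_bigr => x _; apply: eq_bigr => y _; rewrite LM.
Qed.

Lemma eq_psd L M : (forall z w, L z w = M z w) -> psd L -> psd M.
Proof. by move=> LM Lpsd s; rewrite -(eq_form s s LM). Qed.

Lemma form_cat L s1 s2 t1 t2 : form L (s1 ++ s2) (t1 ++ t2) =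
  form L s1 t1 + form L s1 t2 + (form L s2 t1 + form L s2 t2).
Proof.
rewrite /form big_cat /=; congr (_ + _); rewrite -big_split /=;
  by apply: eq_bigr => x _; rewrite big_cat.
Qed.

Definition scale (c : C) s := [seq (c * x.1, x.2) | x <- s].

Lemma form_scalel L c s t : form L (scale c s) t = c * form L s t.
Proof.
rewrite /form big_map mulr_sumr; apply: eq_bigr => x _; rewrite mulr_sumr.
by apply: eq_bigr => y _; rewrite !mulrA.
Qed.

Lemma form_scaler L c s t : form L s (scale c t) = c^*%C * form L s t.
Proof.
rewrite /form mulr_sumr; apply: eq_bigr => x _.
rewrite big_map mulr_sumr; apply: eq_bigr => y _ /=.
by rewrite rmorphM; ring.
Qed.

Lemma formD L M s t : form (fun z w => L z w + M z w) s t = form L s t + form M s t.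
Proof.
rewrite /form -big_split; apply: eq_bigr => x _; rewrite -big_split /=.
by apply: eq_bigr => y _; rewrite mulrDr.
Qed.

Lemma formZ c L s t : form (fun z w => c * L z w) s t = c * form L s t.
Proof.
rewrite /form mulr_sumr; apply: eq_bigr => x _; rewrite mulr_sumr.
by apply: eq_bigr => y _; rewrite mulrCA.
Qed.

End PositiveKernels.

Section WeightedPullback.
Context {R : realType} (X Y : Type).
Local Notation C := (R[i]).
Implicit Types (L : X -> X -> C) (f g : Y -> C) (b : Y -> X) (s t : seq (C * Y)).

(** The adjoint of the weighted composition operator [g |-> f * (g \o b)] acts
    on the kernel functions by this transformation of formal combinations. *)
Definition twist f b s : seq (C * X) :=
  [seq (x.1 * (f x.2)^*%C, b x.2) | x <- s].

Lemma form_twist L f g b s t : form L (twist f b s) (twist g b t) =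
  form (fun z w => g z * (f w)^*%C * L (b z) (b w)) s t.
Proof.
rewrite /form big_map; apply: eq_bigr => x _.
rewrite big_map; apply: eq_bigr => y _ /=.
by rewrite rmorphM /= conjcK; ring.
Qed.

Lemma psd_twist L f b : psd L ->
  psd (fun z w => f z * (f w)^*%C * L (b z) (b w)).
Proof. by move=> Lpsd s; rewrite -form_twist. Qed.

End WeightedPullback.

Section PositiveKernelCalculus.
Context {R : realType} (X : Type).
Local Notation C := (R[i]).
Implicit Types (L M : X -> X -> C).

Lemma psdD L M : psd L -> psd M -> psd (fun z w => L z w + M z w).
Proof. by move=> Lpsd Mpsd s; rewrite formD addr_ge0. Qed.

Lemma psdZ c L : 0 <= c -> psd L -> psd (fun z w => c * L z w).
Proof. by move=> c0 Lpsd s; rewrite formZ mulr_ge0. Qed.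

Lemma psd1 : psd (fun _ _ : X => 1 : C).
Proof.
move=> s; pose v := \sum_(x <- s) x.1.
suff -> : form (fun _ _ : X => 1 : C) s s = v * v^*%C by exact: mulcJ_ge0.
rewrite /form mulr_suml; apply: eq_bigr => x _.
by rewrite rmorph_sum mulr_sumr; apply: eq_bigr => y _; rewrite mulr1.
Qed.

Lemma psd_rank1 (f : X -> C) : psd (fun z w => f z * (f w)^*%C).
Proof.
by apply: eq_psd (psd_twist f id psd1) => z w; rewrite mulr1.
Qed.

Lemma psd_sum (J : Type) (r : seq J) (L : J -> X -> X -> C) :
  (forall j, psd (L j)) -> psd (fun z w => \sum_(j <- r) L j z w).
Proof.
move=> Lpsd; elim: r => [|j r IH].
  apply: eq_psd (psdZ (lexx 0) psd1) => z w; by rewrite big_nil mul0r.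
by apply: eq_psd (psdD (Lpsd j) IH) => z w; rewrite big_cons.
Qed.

Lemma psd_lim (L : nat -> X -> X -> C) M : (forall k, psd (L k)) ->
  (forall z w, ccvg (fun k => L k z w) (M z w)) -> psd M.
Proof.
move=> Lpsd LM s.
apply: (@ccvg_ge0 _ (fun k => form (L k) s s)) => [k|]; first exact: Lpsd.
rewrite /form; apply: ccvg_sum => x; apply: ccvg_sum => y.
by apply: ccvgM => //; exact: ccvg_cst.
Qed.

Lemma psd_diag L z : psd L -> 0 <= L z z.
Proof.
move=> /(_ [:: (1, z)]).
by rewrite /form !big_seq1 conjc1 !mul1r.
Qed.

Lemma form_pair L c d z w : form L [:: (c, z); (d, w)] [:: (c, z); (d, w)] =
  c * c^*%C * L z z + c * d^*%C * L w z + (d * c^*%C * L z w + d * d^*%C * L w w).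
Proof. by rewrite /form !big_cons !big_nil /= !addr0. Qed.

Lemma psd_conj L z w : psd L -> L w z = (L z w)^*%C.
Proof.
move=> Lpsd; have := Lpsd [:: (1, z); (1, w)]; have := Lpsd [:: (1, z); ('i%C, w)].
have := psd_diag z Lpsd; have := psd_diag w Lpsd.
rewrite !form_pair !lecE !(ImD, ReD, ImM, ReM) /=.
move: (L z z) (L z w) (L w z) (L w w) => [a a'] [b b'] [c c'] [d d'] /=.
move=> /andP[/eqP d0 _] /andP[/eqP a0 _] /andP[/eqP h1 _] /andP[/eqP h2 _].
apply: complex_eqP => /=; lra.
Qed.

(** A nonzero [L z p] could be amplified at no cost by the coefficient at [p],
    making the form of a combination of [p] and [z] negative. *)
Lemma psd_row_eq0 L z p : psd L -> L p p = 0 -> L z p = 0.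
Proof.
move=> Lpsd Lp; apply: eq0_normc; apply/eqP.
set N : R := normc _; apply/negPn/negP => N0.
(* With this coefficient the form takes the value [-1]. *)
pose r : R := - (complex.Re (L z z) + 1) / (2 * N ^+ 2).
have := Re_ge0 (Lpsd [:: (r%:C%C * (L z p)^*%C, p); (1, z)]).
rewrite form_pair Lp (psd_conj z p Lpsd).
have -> (x y : C) : complex.Re (r%:C%C * x^*%C * (r%:C%C * x^*%C)^*%C * 0 +
    r%:C%C * x^*%C * 1^*%C * x +
    (1 * (r%:C%C * x^*%C)^*%C * x^*%C + 1 * 1^*%C * y)) =
    complex.Re y + 2 * r * normc x ^+ 2.
  by rewrite sqr_normcE; case: x y => [a b] [c d] /=; ring.
have -> : 2 * r * normc (L z p) ^+ 2 = - (complex.Re (L z z) + 1).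
  by rewrite -/N /r; field.
by rewrite opprD addrA subrr sub0r lerNr oppr0 ler10.
Qed.

(** This is the Gram kernel of the projections of the kernel functions onto the
    orthogonal complement of the kernel function at [p]. When [L p p = 0] it is
    [L] itself, because division by zero gives zero. *)
Definition schur_complement L p z w := L z w - L z p * L p w / L p p.

Lemma schur_complementE L p z w : psd L ->
  L z w = schur_complement L p z w + (L p p)^-1 * (L z p * (L w p)^*%C).
Proof. by move=> Lpsd; rewrite -(psd_conj w p Lpsd) /schur_complement; ring. Qed.

(** When [L p p] is nonzero, adjoining [p] to [s] with the coefficient that
    minimises the form of [L] gives the value of the form of the Schur complement. *)
Lemma psd_schur_complement L p : psd L -> psd (schur_complement L p).
Proof.
move=> Lpsd s; have Lpp := psd_diag p Lpsd.
pose v := \sum_(x <- s) x.1 * L p x.2.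
have vconj : v^*%C = \sum_(x <- s) (x.1)^*%C * L x.2 p.
  by rewrite rmorph_sum; apply: eq_bigr => x _; rewrite rmorphM /= -psd_conj.
have -> : form (schur_complement L p) s s = form L s s - v * v^*%C / L p p.
  have -> : form L s s = form (schur_complement L p) s s +
      (L p p)^-1 * form (fun z w => L z p * (L w p)^*%C) s s.
    rewrite -formZ -formD; apply: eq_form => z w; exact: schur_complementE.
  suff -> : form (fun z w => L z p * (L w p)^*%C) s s = v * v^*%C by ring.
  rewrite vconj /form mulr_suml; apply: eq_bigr => x _.
  rewrite mulr_sumr; apply: eq_bigr => y _.
  by rewrite -(psd_conj x.2 p Lpsd); ring.
have [Lp0|Lp0] := eqVneq (L p p) 0; first by rewrite Lp0 invr0 mulr0 subr0.
have := Lpsd ([:: (- v / L p p, p)] ++ s); rewrite form_cat.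
have -> : form L [:: (- v / L p p, p)] s = - v / L p p * v^*%C.
  rewrite /form big_seq1 /= vconj mulr_sumr; apply: eq_bigr => y _ /=; ring.
have -> : form L s [:: (- v / L p p, p)] = v * (- v / L p p)^*%C.
  by rewrite /form mulr_suml; apply: eq_bigr => y _; rewrite big_seq1 /=; ring.
rewrite /form !big_seq1 /= -/(form L s s) rmorphM rmorphN fmorphV /=.
rewrite (conj_ge0_id Lpp).
by congr (0 <= _); field.
Qed.

(** This is the positivity of a diagonal entry of the Schur complement. *)
Lemma psd_cauchy_schwarz L z w : psd L ->
  normc (L z w) ^+ 2 <= complex.Re (L z z) * complex.Re (L w w).
Proof.
move=> Lpsd; have Lz := psd_diag z Lpsd; have Lw := psd_diag w Lpsd.
have [L0|L0] := eqVneq (L w w) 0.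
  by rewrite (psd_row_eq0 z Lpsd L0) normc0 expr0n mulr_ge0 ?Re_ge0.
have := psd_diag z (psd_schur_complement w Lpsd).
rewrite /schur_complement (psd_conj z w Lpsd) mul_conjE.
rewrite {1}(ge0_realE Lz) (ge0_realE Lw) -fmorphV -rmorphM -rmorphB ler0c.
rewrite subr_ge0 ler_pdivrMr//.
rewrite lt_neqAle Re_ge0// andbT eq_sym; apply: contra L0 => /eqP h.
by rewrite (ge0_realE Lw) h.
Qed.

(** Schur's product theorem. The Schur complement of [L] at the first point of
    [s] has vanishing row and column there, which leaves a shorter combination,
    while the remaining rank one part of [L] is absorbed in the coefficients. *)
Theorem psdM L M : psd L -> psd M -> psd (fun z w => L z w * M z w).
Proof.
move=> Lpsd Mpsd s; elim: s L Lpsd => [|[c p] s IH] L Lpsd.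
  by rewrite /form big_nil.
set L' := schur_complement L p.
have L'psd : psd L' by exact: psd_schur_complement.
have L'p z : L' z p = 0.
  rewrite /L' /schur_complement; have [L0|L0] := eqVneq (L p p) 0.
    by rewrite (psd_row_eq0 z Lpsd L0) !mul0r subr0.
  by rewrite mulfK// subrr.
have pL' z : L' p z = 0 by rewrite (psd_conj z p L'psd) L'p conjc0.
have -> : form (fun z w => L z w * M z w) ((c, p) :: s) ((c, p) :: s) =
    form (fun z w => L' z w * M z w) ((c, p) :: s) ((c, p) :: s) +
    (L p p)^-1 * form M (twist (fun z => L z p) id ((c, p) :: s))
                        (twist (fun z => L z p) id ((c, p) :: s)).
  rewrite form_twist -formZ -formD; apply: eq_form => z w.
  by rewrite (schur_complementE p z w Lpsd) -/L'; ring.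
apply: addr_ge0; last by rewrite mulr_ge0 ?invr_ge0 ?psd_diag.
rewrite -cat1s form_cat.
have col0 t : form (fun z w => L' z w * M z w) t [:: (c, p)] = 0.
  by rewrite /form big1// => x _; rewrite big_seq1 /= pL' mul0r mulr0.
have row0 t : form (fun z w => L' z w * M z w) [:: (c, p)] t = 0.
  by rewrite /form big_seq1 big1// => x _; rewrite /= L'p mul0r mulr0.
by rewrite !col0 row0 !add0r; exact: IH.
Qed.

End PositiveKernelCalculus.

(** * The seminorm of a positive semidefinite kernel *)

Section KernelSeminorm.
Context {R : realType} (X : Type) (K : X -> X -> R[i]).
Local Notation C := (R[i]).
Hypothesis Kpsd : psd K.
Implicit Types (s t : seq (C * X)).

Definition knorm s : R := Num.sqrt (complex.Re (form K s s)).

Lemma knorm_ge0 s : 0 <= knorm s.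
Proof. exact: sqrtr_ge0. Qed.

Lemma sqr_knorm s : (knorm s ^+ 2) = complex.Re (form K s s).
Proof. by rewrite sqr_sqrtr// Re_ge0. Qed.

Lemma form_knorm s : form K s s = (knorm s ^+ 2)%:C%C.
Proof. by rewrite sqr_knorm -ge0_realE. Qed.

(** Positivity passes from points to formal combinations of points, which gives
    the Cauchy-Schwarz inequality for [form K] as an instance of the one for
    kernels. *)
Lemma psd_form : psd (fun t s => form K s t).
Proof.
move=> S; pose flat (T : seq (C * seq (C * X))) : seq (C * X) :=
  flatten [seq scale x.1 x.2 | x <- T].
suff -> : form (fun t s => form K s t) S S = form K (flat S) (flat S) by [].
have flatr s T : form K s (flat T) = \sum_(y <- T) (y.1)^*%C * form K s y.2.
  elim: T => [|y T IH].
    by rewrite big_nil /form big1// => x _; rewrite big_nil.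
  rewrite big_cons -IH /flat /= -[s in LHS]cats0 form_cat.
  have nil0 t : form K [::] t = 0 by rewrite /form big_nil.
  rewrite !nil0 !addr0; congr (_ + _).
  exact: form_scaler.
have flatl S' t : form K (flat S') t = \sum_(x <- S') x.1 * form K x.2 t.
  elim: S' => [|x S' IH]; first by rewrite big_nil /form big_nil.
  rewrite big_cons -IH /flat /= -[t in LHS]cats0 form_cat.
  have nil0 s : form K s [::] = 0 by rewrite /form big1// => y _; rewrite big_nil.
  rewrite !nil0 !addr0; congr (_ + _).
  exact: form_scalel.
rewrite flatl; apply: eq_bigr => x _; rewrite flatr mulr_sumr.
by apply: eq_bigr => y _; rewrite mulrA.
Qed.

Lemma normc_form_le s t : normc (form K s t) <= knorm s * knorm t.
Proof.
rewrite -(@ler_pXn2r _ 2) ?nnegrE ?normc_ge0 ?mulr_ge0 ?knorm_ge0//.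
rewrite exprMn !sqr_knorm mulrC.
exact: (psd_cauchy_schwarz t s psd_form).
Qed.

Lemma form_conj s t : form K t s = (form K s t)^*%C.
Proof. exact: (psd_conj t s psd_form). Qed.

Lemma sqr_knorm_cat s t : knorm (s ++ t) ^+ 2 =
  knorm s ^+ 2 + knorm t ^+ 2 + 2 * complex.Re (form K s t).
Proof. by rewrite !sqr_knorm form_cat (form_conj s t) !ReD ReJ; ring. Qed.

Lemma knorm_cat s t : knorm (s ++ t) <= knorm s + knorm t.
Proof.
rewrite -(@ler_pXn2r _ 2) ?nnegrE ?addr_ge0 ?knorm_ge0//.
have : complex.Re (form K s t) <= knorm s * knorm t.
  exact: le_trans (ler_norm _) (le_trans (Re_le_normc _) (normc_form_le _ _)).
rewrite sqr_knorm_cat sqrrD; lra.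
Qed.

Lemma knorm_scale c s : knorm (scale c s) = normc c * knorm s.
Proof.
rewrite /knorm form_scalel form_scaler mulrA mul_conjE form_knorm -rmorphM /= -exprMn sqrtr_sqr.
by rewrite ger0_norm ?mulr_ge0 ?normc_ge0 ?knorm_ge0// sqrtr_sqr ger0_norm ?knorm_ge0.
Qed.

End KernelSeminorm.

(** * Hilbert spaces of functions *)

Section HilbertFunctionSpaces.
Context {R : realType} (X : Type) (H : hilbert_fun_space (R := R) X).
Local Notation C := (R[i]).
Implicit Types (f g h : X -> C).

Definition lincomb (Y : Type) (e : Y -> X -> C) (s : seq (C * Y)) : X -> C :=
  fun z => \sum_(x <- s) x.1 * e x.2 z.

Lemma lincomb_cons (Y : Type) (e : Y -> X -> C) x s :
  lincomb e (x :: s) = fun z => x.1 * e x.2 z + lincomb e s z.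
Proof. by apply/funext => z; rewrite /lincomb big_cons. Qed.

Lemma lincomb_nil (Y : Type) (e : Y -> X -> C) : lincomb e [::] = fun=> 0.
Proof. by apply/funext => z; rewrite /lincomb big_nil. Qed.

Section Lincomb.
Variables (Y : Type) (e : Y -> X -> C).
Hypothesis He : forall y, carrier H (e y).

Lemma carrier_lincomb s : carrier H (lincomb e s).
Proof.
elim: s => [|x s IH]; first by rewrite lincomb_nil; exact: carrier0.
by rewrite lincomb_cons; exact: carrier_lin.
Qed.

Lemma ip0l f : carrier H f -> ip H (fun=> 0) f = 0.
Proof.
move=> Hf; have /eqP := ip_linl 1 (carrier0 H) (carrier0 H) Hf.
rewrite [X in ip H X](_ : _ = fun=> 0); last by apply/funext => z; rewrite mulr0 addr0.
by rewrite mul1r -subr_eq subrr eq_sym => /eqP.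
Qed.

Lemma ip_lincombl s f : carrier H f ->
  ip H (lincomb e s) f = \sum_(x <- s) x.1 * ip H (e x.2) f.
Proof.
move=> Hf; elim: s => [|x s IH]; first by rewrite lincomb_nil big_nil ip0l.
rewrite lincomb_cons ip_linl//; last exact: carrier_lincomb.
by rewrite IH big_cons.
Qed.

Lemma ip_lincombr s f : carrier H f ->
  ip H f (lincomb e s) = \sum_(x <- s) (x.1)^*%C * ip H f (e x.2).
Proof.
move=> Hf; rewrite ip_conj//; last exact: carrier_lincomb.
rewrite ip_lincombl// rmorph_sum; apply: eq_bigr => x _.
by rewrite rmorphM /= -ip_conj.
Qed.

Lemma ip_lincomb s t : ip H (lincomb e s) (lincomb e t) =
  form (fun y x => ip H (e x) (e y)) s t.
Proof.
rewrite ip_lincombl; last exact: carrier_lincomb.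
apply: eq_bigr => x _; rewrite ip_lincombr// mulr_sumr.
by apply: eq_bigr => y _; rewrite mulrA.
Qed.

Lemma psd_gram : psd (fun y x => ip H (e x) (e y)).
Proof. by move=> s; rewrite -ip_lincomb; apply: ip_ge0; exact: carrier_lincomb. Qed.

End Lincomb.

Lemma hnorm_ge0 f : 0 <= hnorm H f.
Proof. exact: sqrtr_ge0. Qed.

Lemma sqr_hnorm f : carrier H f -> ip H f f = (hnorm H f ^+ 2)%:C%C.
Proof.
move=> Hf; have f0 := ip_ge0 Hf.
by rewrite sqr_sqrtr ?Re_ge0// -ge0_realE.
Qed.

Lemma normc_ip_le f g : carrier H f -> carrier H g ->
  normc (ip H f g) <= hnorm H f * hnorm H g.
Proof.
move=> Hf Hg; pose e (y : bool) := if y then f else g.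
have He y : carrier H (e y) by case: y.
have := psd_cauchy_schwarz false true (psd_gram He); rewrite /e /=.
rewrite !sqr_hnorm//= mulrC -exprMn.
by rewrite ler_pXn2r ?nnegrE ?normc_ge0 ?mulr_ge0 ?hnorm_ge0.
Qed.

Lemma carrierB f g : carrier H f -> carrier H g -> carrier H (fun x => f x - g x).
Proof.
move=> Hf Hg; have := carrier_lin (-1) Hg Hf; congr carrier.
by apply/funext => x; rewrite mulN1r addrC.
Qed.

Lemma ipBl f g h : carrier H f -> carrier H g -> carrier H h ->
  ip H (fun x => f x - g x) h = ip H f h - ip H g h.
Proof.
move=> Hf Hg Hh; rewrite addrC -mulN1r -ip_linl//; congr ip.
by apply/funext => x; rewrite mulN1r addrC.
Qed.

Lemma hnorm_le_dist f g : carrier H f -> carrier H g ->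
  hnorm H f <= hnorm H g + hnorm H (fun x => f x - g x).
Proof.
move=> Hf Hg; have Hd := carrierB Hf Hg.
have [->|f0] := eqVneq (hnorm H f) 0; first by rewrite addr_ge0 ?hnorm_ge0.
have {f0} f0 : 0 < hnorm H f by rewrite lt_neqAle eq_sym f0 hnorm_ge0.
rewrite -(ler_pM2l f0) -expr2 -(normc_realE (exprn_ge0 2 (hnorm_ge0 f))).
rewrite -sqr_hnorm//.
have -> : ip H f f = ip H g f + ip H (fun x => f x - g x) f.
  by rewrite ipBl// addrC subrK.
rewrite (le_trans (le_normcD _ _))// mulrC mulrDl.
by rewrite lerD// normc_ip_le.
Qed.

End HilbertFunctionSpaces.

(** * Reproducing kernels *)

Section ReproducingKernels.
Context {R : realType} (X : Type) (H : hilbert_fun_space (R := R) X).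
Local Notation C := (R[i]).
Variable K : X -> X -> C.
Hypothesis HK : reproducing_kernel H K.
Implicit Types (f g h : X -> C) (s t : seq (C * X)).

Local Notation ksum := (lincomb (fun w z => K z w)).

Lemma carrier_kernel w : carrier H (fun z => K z w).
Proof. by have [] := HK w. Qed.

Lemma reproducing f w : carrier H f -> f w = ip H f (fun z => K z w).
Proof. by have [_] := HK w; exact. Qed.

Lemma gram_kernel z w : ip H (fun x => K x w) (fun x => K x z) = K z w.
Proof. by rewrite -reproducing//; exact: carrier_kernel. Qed.

Lemma reproducing_psd : psd K.
Proof. by apply: eq_psd (psd_gram carrier_kernel) => z w; exact: gram_kernel. Qed.

Lemma hnorm_ksum s : hnorm H (ksum s) = knorm K s.
Proof.
rewrite /hnorm /ip_norm ip_lincomb; last exact: carrier_kernel.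
by rewrite /knorm (eq_form s s gram_kernel).
Qed.

Lemma ip_ksumr f s : carrier H f ->
  ip H f (ksum s) = \sum_(x <- s) (x.1)^*%C * f x.2.
Proof.
move=> Hf; rewrite ip_lincombr//; last exact: carrier_kernel.
by apply: eq_bigr => x _; rewrite -reproducing.
Qed.

Lemma ksumB s t : ksum (s ++ scale (-1) t) = fun z => ksum s z - ksum t z.
Proof.
apply/funext => z; rewrite /lincomb big_cat big_map -sumrN; congr (_ + _).
by apply: eq_bigr => x _ /=; rewrite mulN1r mulNr.
Qed.

(** Riesz representation: [h] is found by minimising
    [|g|^2 - 2 Re L(g)], where [L] maps the kernel function at [w] to the
    conjugate of [h w], over the combinations [g] of kernel functions. By the
    parallelogram identity a minimising sequence is Cauchy; that its limit takes
    the values of [h] is the first order condition at the minimum. *)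
Theorem carrier_of_bounded_functional h M : 0 <= M ->
  (forall s, normc (\sum_(x <- s) x.1 * (h x.2)^*%C) <= M * knorm K s) ->
  carrier H h /\ hnorm H h <= M.
Proof.
move=> M0 hM; have Kpsd := reproducing_psd.
pose L s := complex.Re (\sum_(x <- s) x.1 * (h x.2)^*%C).
have Lcat s t : L (s ++ t) = L s + L t by rewrite /L big_cat ReD.
have Lscale (r : R) s : L (scale r%:C%C s) = r * L s.
  rewrite /L big_map (eq_bigr (fun x => r%:C%C * (x.1 * (h x.2)^*%C))).
    by rewrite -mulr_sumr ReM /= mul0r subr0.
  by move=> x _; rewrite mulrA.
pose J s := knorm K s ^+ 2 - 2 * L s.
pose E := [set J s | s in [set: seq (C * X)]].
have Jlb : lbound E (- M ^+ 2).
  move=> _ [s _ <-]; have : L s <= M * knorm K s.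
    exact: le_trans (ler_norm _) (le_trans (Re_le_normc _) (hM s)).
  by rewrite /J => ?; have := sqr_ge0 (knorm K s - M); rewrite sqrrB; lra.
have infJ s : inf E <= J s by apply: ge_inf; [exists (- M ^+ 2) | exists s].
have /choice[u uE] : forall k : nat, exists s, J s < inf E + k.+1%:R^-1.
  move=> k; have k0 : 0 < (k.+1%:R : R)^-1 by rewrite invr_gt0.
  have infE : has_inf E by split; [exists (J [::]), [::] | exists (- M ^+ 2)].
  by have [_ [s _ <-] ?] := inf_adherent k0 infE; exists s.
have parallelogram s t : knorm K (s ++ scale (-1) t) ^+ 2 =
    2 * J s + 2 * J t - 4 * J (scale (2^-1)%:C%C (s ++ t)).
  rewrite /J Lscale Lcat knorm_scale// exprMn normc_realE ?invr_ge0//.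
  rewrite !sqr_knorm_cat// knorm_scale// form_scaler normcN normc1.
  have -> : ((-1 : C)^*)%C = -1 by apply: complex_eqP => /=; rewrite ?oppr0.
  by rewrite mulN1r ReN; field.
pose g k := ksum (u k).
have Hg k : carrier H (g k) by apply: carrier_lincomb; exact: carrier_kernel.
have dist_lt p q N : (N <= p)%N -> (N <= q)%N ->
    hnorm H (fun x => g p x - g q x) ^+ 2 <= 4 / N.+1%:R.
  move=> Np Nq; rewrite /g -ksumB hnorm_ksum parallelogram.
  have hp : (p.+1%:R : R)^-1 <= N.+1%:R^-1 by rewrite lef_pV2 ?posrE ?ler_nat.
  have hq : (q.+1%:R : R)^-1 <= N.+1%:R^-1 by rewrite lef_pV2 ?posrE ?ler_nat.
  move: (uE p) (uE q) (infJ (scale (2^-1)%:C%C (u p ++ u q))) hp hq.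
  move: (inf E) (J (u p)) (J (u q)) p.+1%:R^-1 q.+1%:R^-1 N.+1%:R^-1.
  by move=> *; lra.
(* The limit [l] exists because [2 / (p + 1) + 2 / (q + 1) <= 4 / (N + 1)]. *)
have cauchy (e : R) : 0 < e -> exists N, forall p q, (N <= p)%N -> (N <= q)%N ->
    hnorm H (fun x => g p x - g q x) < e.
  move=> e0; exists (Num.bound (4 / e ^+ 2)) => p q Np Nq.
  rewrite -(@ltr_pXn2r _ 2) ?nnegrE ?hnorm_ge0 ?ltW//.
  apply: le_lt_trans (dist_lt p q _ Np Nq) _.
  rewrite ltr_pdivrMr// mulrC -ltr_pdivrMr ?exprn_gt0//.
  have /lt_trans := archi_boundP (divr_ge0 (ler0n R 4) (exprn_ge0 2 (ltW e0))).
  by apply; rewrite ltr_nat.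
have [l Hl gl] := ip_complete Hg cauchy.
have {}gl : hnorm H (fun x => g k x - l x) @[k --> \oo] --> (0 : R) by exact: gl.
have eval_l w : ccvg (g^~ w) (l w).
  apply: ccvg_dist; have Hw := carrier_kernel w.
  apply: (@squeeze_cvgr _ _ _ _ (cst 0) (fun k =>
    hnorm H (fun x => g k x - l x) * hnorm H (fun z => K z w)) _).
  - near=> k; rewrite normc_ge0/= (reproducing w (Hg k)) (reproducing w Hl).
    by rewrite -ipBl// normc_ip_le//; exact: carrierB.
  - exact: cvg_cst.
  - by rewrite -[X in _ --> X](mul0r (hnorm H (fun z => K z w))); apply: cvgMl.
have eval_h w : ccvg (g^~ w) (h w).
  pose kap := complex.Re (K w w); have kap0 : 0 <= kap by exact/Re_ge0/psd_diag.
  (* Moving [u k] by a small multiple of the kernel function at [w], against the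
     defect [d], lowers [J] in proportion to [|d|^2], hence by no more than the
     distance of [J (u k)] to the infimum. *)
  have sqr_le k : normc (g k w - h w) ^+ 2 <= (kap + 1) * k.+1%:R^-1.
    set d := g k w - h w.
    pose tau : R := (kap + 1)^-1.
    have tau0 : 0 < tau by rewrite invr_gt0 ltr_wpDl.
    pose c : C := - (tau%:C%C * d).
    have := infJ (u k ++ [:: (c, w)]); have := uE k.
    have -> : J (u k ++ [:: (c, w)]) =
        J (u k) - 2 * tau * normc d ^+ 2 + tau ^+ 2 * normc d ^+ 2 * kap.
      rewrite /J sqr_knorm_cat// Lcat (sqr_knorm Kpsd [:: _]) [L [:: _]]/L big_seq1 /=.
      have -> : form K (u k) [:: (c, w)] = c^*%C * g k w.
        rewrite /form /g /lincomb mulr_sumr; apply: eq_bigr => x _.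
        by rewrite big_seq1 /=; ring.
      have -> : complex.Re (form K [:: (c, w)] [:: (c, w)]) =
          tau ^+ 2 * normc d ^+ 2 * kap.
        rewrite /form !big_seq1 /= mul_conjE ReM /= mul0r subr0.
        by rewrite /c normcN normcM normc_realE ?exprMn// ltW.
      have -> : complex.Re (c * (h w)^*%C) = complex.Re (c^*%C * h w).
        by rewrite !ReM !ReJ !ImJ; ring.
      have -> : g k w = d + h w by rewrite /d subrK.
      have -> : complex.Re (c^*%C * (d + h w)) =
          complex.Re (c^*%C * h w) - tau * normc d ^+ 2.
        rewrite /c sqr_normcE; case: (d) (h w) => [a a'] [b b'] /=; ring.
      ring.
    move=> h1 h2.
    have tk : tau * kap <= 1.
      by rewrite /tau ler_pdivrMl ?mulr1 ?lerDl ?ltr_wpDl.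
    have h3 : tau * normc d ^+ 2 * (tau * kap) <= tau * normc d ^+ 2.
      by rewrite ler_piMr// mulr_ge0 ?sqr_ge0// ltW.
    have h4 : tau * normc d ^+ 2 <= k.+1%:R^-1.
      have e : tau * normc d ^+ 2 * (tau * kap) = tau ^+ 2 * normc d ^+ 2 * kap by ring.
      rewrite e in h3; move: h1 h2 h3; move: (inf E) (J (u k)) k.+1%:R^-1.
      by move: (normc d ^+ 2) => n2 i j k' h1 h2 h3; lra.
    by rewrite -ler_pdivrMl ?ltr_wpDl.
  apply: ccvg_dist.
  apply: (@squeeze_cvgr _ _ _ _ (cst 0) (fun k =>
    Num.sqrt ((kap + 1) * k.+1%:R^-1)) _).
  - near=> k; rewrite normc_ge0/= -(ger0_norm (normc_ge0 (g k w - h w))) -sqrtr_sqr.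
    exact: ler_wsqrtr.
  - exact: cvg_cst.
  - rewrite -[X in _ --> X](@sqrtr0 R).
    apply: (continuous_cvg _ (@sqrt_continuous R 0)).
    rewrite -[X in _ --> X](mulr0 (kap + 1)).
    by apply: cvgMr; exact: cvg_harmonic.
have hl : h = l by apply/funext => w; exact: ccvg_unique (eval_h w) (eval_l w).
rewrite hl in eval_h hM * => {eval_l}.
split=> //.
(* Pairing with [l] is the given functional on combinations of kernel functions,
   so [|l|^2 <= M |l|] holds up to a multiple of the distance from [l] to [g k]. *)
have norm_le k : hnorm H l ^+ 2 - M * hnorm H l <=
    (M + hnorm H l) * hnorm H (fun x => g k x - l x).
  set dk := hnorm H (fun x => g k x - l x).
  have gk : hnorm H (g k) <= hnorm H l + dk by exact: hnorm_le_dist.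
  have ig : normc (ip H l (g k)) <= M * hnorm H (g k).
    rewrite ip_ksumr// hnorm_ksum; apply: le_trans (hM (u k)).
    rewrite -normcJE rmorph_sum /=.
    by rewrite (eq_bigr (fun x => x.1 * (l x.2)^*%C))// => x _; rewrite rmorphM /= conjcK.
  have id : normc (ip H (fun x => g k x - l x) l) <= dk * hnorm H l.
    by apply: normc_ip_le => //; exact: carrierB.
  have split_norm : hnorm H l ^+ 2 <=
      normc (ip H (g k) l) + normc (ip H (fun x => g k x - l x) l).
    rewrite -(normc_realE (sqr_ge0 _)) -sqr_hnorm//.
    have -> : ip H l l = ip H (g k) l - ip H (fun x => g k x - l x) l.
      by rewrite ipBl// opprB addrC subrK.
    by rewrite (le_trans (le_normcD _ _))// normcN.
  rewrite (ip_conj Hl (Hg k)) normcJE in split_norm.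
  have := ler_wpM2l M0 gk; lra.
have sqr_le : hnorm H l ^+ 2 - M * hnorm H l <= 0.
  have cvg0 : (M + hnorm H l) * hnorm H (fun x => g k x - l x) @[k --> \oo] --> (0 : R).
    by rewrite -[X in _ --> X](mulr0 (M + hnorm H l)); exact: cvgMr.
  by apply: (cvgr_to_ge cvg0); near=> k; exact: norm_le.
have [->//|l0] := eqVneq (hnorm H l) 0.
have {}l0 : 0 < hnorm H l by rewrite lt_neqAle eq_sym l0 hnorm_ge0.
by rewrite -(ler_pM2r l0) -expr2 -subr_le0.
Unshelve. all: by end_near. Qed.

(** The values of [f * (g \o b)] are the pairings of [g] with the images of the
    kernel functions under [twist f b], so a bound for [twist f b] on formal
    combinations bounds the functional attached to [f * (g \o b)]. *)
Lemma weighted_composition_bounded f (b : X -> X) M : 0 <= M ->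
  (forall s, knorm K (twist f b s) <= M * knorm K s) ->
  bounded_op H (fun g => mul_op f (comp_op b g)) /\
  opnorm H (fun g => mul_op f (comp_op b g)) <= M.
Proof.
move=> M0 fbM.
have op_le g : carrier H g -> carrier H (mul_op f (comp_op b g)) /\
    hnorm H (mul_op f (comp_op b g)) <= M * hnorm H g.
  move=> Hg; apply: carrier_of_bounded_functional => [|s].
    by rewrite mulr_ge0 ?hnorm_ge0.
  have -> : \sum_(x <- s) x.1 * (mul_op f (comp_op b g) x.2)^*%C =
      (ip H g (ksum (twist f b s)))^*%C.
    rewrite ip_ksumr// big_map rmorph_sum; apply: eq_bigr => x _ /=.
    by rewrite /mul_op /comp_op !rmorphM /= !conjcK mulrA.
  rewrite normcJE.
  apply: le_trans (normc_ip_le Hg (carrier_lincomb carrier_kernel _)) _.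
  by rewrite hnorm_ksum [M * _]mulrC -mulrA ler_wpM2l ?hnorm_ge0.
split; first by split=> [g /op_le[]//|]; exists M => g /op_le[].
apply: ge_sup.
  exists (hnorm H (mul_op f (comp_op b (fun=> 0)))), (fun=> 0) => //; split.
    exact: carrier0.
  by rewrite /hnorm /ip_norm ip0l ?sqrtr0//; exact: carrier0.
move=> _ [g [Hg g1] <-]; have [_ /le_trans] := op_le g Hg; apply.
by rewrite ler_piMr.
Qed.

End ReproducingKernels.

(** * Bounded multipliers *)

Section Multipliers.
Context {R : realType} (X : Type) (K : X -> X -> R[i]).
Local Notation C := (R[i]).
Hypothesis Kpsd : psd K.
Implicit Types (s t : seq (C * X)) (f : X -> C).

Lemma knorm_leP (c : C) s t : 0 <= c ->
  (knorm K t <= complex.Re c * knorm K s) = (0 <= c ^+ 2 * form K s s - form K t t).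
Proof.
move=> c0; rewrite {2}(ge0_realE c0) !form_knorm// -rmorphXn -rmorphM -rmorphB ler0c.
rewrite subr_ge0 -exprMn ler_pXn2r// ?nnegrE ?knorm_ge0// mulr_ge0 ?knorm_ge0//.
exact: Re_ge0.
Qed.

Lemma twist_bounded f (b : X -> X) (c : R) : 0 <= c ->
  psd (fun z w => (c ^+ 2)%:C%C * K z w - f z * (f w)^*%C * K (b z) (b w)) ->
  forall s, knorm K (twist f b s) <= c * knorm K s.
Proof.
move=> c0 hpsd s; have c0' : 0 <= c%:C%C :> C by rewrite ler0c.
rewrite (knorm_leP s _ c0') form_twist -rmorphXn -formZ -mulN1r -formZ -formD.
by under eq_form do rewrite mulN1r; exact: hpsd.
Qed.

(** Multipliers together with bounds for their norms, coded as functions on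
    [option X] whose value at [None] is the bound, form a class to which the
    calculus of negative powers applies. *)
Definition bounded_multiplier (u : option X -> C) : Prop :=
  0 <= u None /\ forall s,
    knorm K (twist (fun z => u (Some z)) id s) <= complex.Re (u None) * knorm K s.

Lemma bounded_multiplier_semiring : limit_semiring bounded_multiplier.
Proof.
split=> [r r0|u v [u0 uK] [v0 vK]|u v [u0 uK] [v0 vK]|v u vK vu].
- split=> [|s]; first by rewrite ler0c.
  have -> : twist (fun=> r%:C%C) id s = scale r%:C%C s.
    by apply: eq_map => x; rewrite conjc_real mulrC.
  by rewrite knorm_scale// normc_realE.
- split=> [|s]; first exact: addr_ge0.
  have -> : knorm K (twist (fun z => u (Some z) + v (Some z)) id s) =
      knorm K (twist (fun z => u (Some z)) id s ++ twist (fun z => v (Some z)) id s).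
    rewrite /knorm form_cat !form_twist -!formD; congr (Num.sqrt (complex.Re _)).
    by apply: eq_form => z w; rewrite rmorphD; ring.
  rewrite (le_trans (knorm_cat Kpsd _ _))// ReD mulrDl.
  by rewrite lerD.
- split=> [|s]; first exact: mulr_ge0.
  have -> : twist (fun z => u (Some z) * v (Some z)) id s =
      twist (fun z => u (Some z)) id (twist (fun z => v (Some z)) id s).
    rewrite /twist -map_comp; apply: eq_map => x /=.
    by rewrite rmorphM /=; congr (_, _); ring.
  rewrite (le_trans (uK _))// {2}(ge0_realE u0) {1}(ge0_realE v0) -rmorphM /=.
  by rewrite -mulrA ler_wpM2l// Re_ge0.
- have u0 : 0 <= u None by apply: ccvg_ge0 (vu None) => k; have [] := vK k.
  split=> // s; rewrite knorm_leP//.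
  apply: (@ccvg_ge0 _ (fun k => v k None ^+ 2 * form K s s -
    form K (twist (fun z => v k (Some z)) id s) (twist (fun z => v k (Some z)) id s))).
    by move=> k; have [vk0 vk] := vK k; rewrite -knorm_leP.
  apply: ccvgB.
    by apply: ccvgM; [exact: ccvgM | exact: ccvg_cst].
  rewrite form_twist; under eq_fun do rewrite form_twist.
  rewrite /form; apply: ccvg_sum => x; apply: ccvg_sum => y.
  apply: ccvgM; first exact: ccvg_cst.
  by apply: ccvgM; [apply: ccvgM => //; exact: ccvgJ | exact: ccvg_cst].
Qed.

(** At [None] the calculus computes [(1 - r) ^ (- a)], which is thereby the bound
    for the multiplier computed at the points. *)
Lemma multiplier_negative_power f (r a : R) : 0 <= r < 1 -> 0 <= a ->
  (forall z, normc (f z) < 1) ->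
  (forall s, knorm K (twist f id s) <= r * knorm K s) ->
  forall s, knorm K (twist (fun z => Cpow (1 - f z) (- a)) id s) <=
    (1 - r) `^ (- a) * knorm K s.
Proof.
move=> /andP[r0 r1] a0 f1 fK s.
pose u o := if o is Some z then f z else r%:C%C.
have Qu : bounded_multiplier u by split; rewrite /= ?ler0c.
have u1 o : normc (u o) < 1 by case: o => [z|]; [exact: f1 | rewrite normc_realE].
have [_ /(_ s)] := semiring_negative_power bounded_multiplier_semiring Qu u1 a0.
have -> : 1 - u None = (1 - r)%:C%C by rewrite rmorphB rmorph1.
by rewrite Cpow_real// subr_gt0.
Qed.

End Multipliers.

Lemma psd_semiring (R : realType) (X : Type) :
  limit_semiring (fun u : X * X -> R[i] => psd (fun z w => u (z, w))).
Proof.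
split=> [r r0|u v|u v|v u vpsd vu].
- by apply: eq_psd (psdZ (_ : 0 <= r%:C%C) (@psd1 R X)) => [z w|]; rewrite ?mulr1 ?ler0c.
- exact: psdD.
- exact: psdM.
- by apply: psd_lim vpsd _ => z w; exact: vu.
Qed.

(** * The inner product on the unit ball *)

Section UnitBall.
Context {R : realType} {n : nat}.
Local Notation C := (R[i]).
Implicit Types x y a : 'rV[C]_n.

Lemma enorm_ge0 x : 0 <= enorm x.
Proof. exact: sqrtr_ge0. Qed.

Lemma cdot_conj x y : cdot y x = (cdot x y)^*%C.
Proof.
rewrite /cdot rmorph_sum; apply: eq_bigr => i _.
by rewrite rmorphM /= conjcK mulrC.
Qed.

Lemma cdotxx x : cdot x x = (enorm x ^+ 2)%:C%C.
Proof.
rewrite sqr_sqrtr ?sumr_ge0// => [|i _]; last exact: sqr_ge0.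
by rewrite rmorph_sum; apply: eq_bigr => i _; exact: mul_conjE.
Qed.

Lemma cdotx0 x : cdot x 0 = 0.
Proof. by rewrite /cdot big1// => i _; rewrite mxE conjc0 mulr0. Qed.

(** Lagrange's identity writes this kernel as a sum of squares. *)
Lemma psd_lagrange a :
  psd (fun x y => (enorm a ^+ 2)%:C%C * cdot x y - cdot x a * cdot a y).
Proof.
pose m i j x : C := x ord0 i * a ord0 j - x ord0 j * a ord0 i.
have half0 : 0 <= 2^-1 :> C by rewrite invr_ge0.
apply: eq_psd (psdZ half0 (psd_sum (index_enum 'I_n) (fun i =>
  psd_sum (index_enum 'I_n) (fun j => psd_rank1 (m i j))))) => x y.
rewrite -cdotxx.
have -> : \sum_i \sum_j m i j x * (m i j y)^*%C =
    2 * (cdot x y * cdot a a - cdot x a * cdot a y).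
  pose p i j : C := x ord0 i * (y ord0 i)^*%C * (a ord0 j * (a ord0 j)^*%C).
  pose q i j : C := x ord0 i * (a ord0 i)^*%C * (a ord0 j * (y ord0 j)^*%C).
  have -> : cdot x y * cdot a a = \sum_i \sum_j p i j by rewrite big_distrlr.
  have -> : cdot x a * cdot a y = \sum_i \sum_j q i j by rewrite big_distrlr.
  transitivity (\sum_i \sum_j (p i j + p j i - (q i j + q j i))).
    apply: eq_bigr => i _; apply: eq_bigr => j _.
    by rewrite /m /p /q rmorphB !rmorphM /=; ring.
  under eq_bigr do rewrite sumrB !big_split /=.
  rewrite sumrB !big_split /= (exchange_big_dep predT)//=.
  rewrite [X in _ + _ - (_ + X)](exchange_big_dep predT)//=.
  by ring.
by rewrite mulrA mulVf ?mul1r ?pnatr_eq0// mulrC.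
Qed.

Lemma normc_cdot_le x y : normc (cdot x y) <= enorm x * enorm y.
Proof.
rewrite -(@ler_pXn2r _ 2) ?nnegrE ?normc_ge0 ?mulr_ge0 ?enorm_ge0//.
have := psd_diag x (psd_lagrange y).
rewrite (cdot_conj x y) mul_conjE cdotxx -rmorphM -rmorphB ler0c subr_ge0.
by rewrite exprMn mulrC.
Qed.

Lemma normc_cdot_lt1 (z w : Ball R n) : normc (cdot (sval z) (sval w)) < 1.
Proof.
apply: le_lt_trans (normc_cdot_le _ _) _.
by rewrite mulr_ilt1 ?enorm_ge0//; [exact: (proj2_sig z) | exact: (proj2_sig w)].
Qed.

Lemma Re_1Bcdot_gt0 (z w : Ball R n) : 0 < complex.Re (1 - cdot (sval z) (sval w)).
Proof. exact/Re_1B_gt0/normc_cdot_lt1. Qed.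

End UnitBall.

(** * Weighted composition operators on the ball *)

Section CompositionOnBall.
Context {R : realType} {n : nat} (b : Ball R n -> Ball R n) (alpha : R).
Local Notation C := (R[i]).
Local Notation X := (Ball R n).
Local Notation K := (kernel_alpha (n := n) alpha).
Local Notation Kb := (kernel_b b alpha).
Hypothesis alpha1 : 1 <= alpha.
Hypothesis Kpsd : psd K.
Hypothesis Kbpsd : psd Kb.

Let bb (z w : X) : C := cdot (sval (b z)) (sval (b w)).
Let a := sval (b ball_origin).

Lemma kernel_bE (z w : X) :
  Kb z w = Cpow (1 - bb z w) alpha / Cpow (1 - cdot (sval z) (sval w)) alpha.
Proof. by rewrite /kernel_b Cpow_div ?Re_1Bcdot_gt0. Qed.

Lemma kernel_alpha_factor (z w : X) : K z w = Kb z w * K (b z) (b w).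
Proof.
rewrite kernel_bE /kernel_alpha -/(bb z w); have p0 := Cpow_neq0 (1 - bb z w) alpha.
have q0 := Cpow_neq0 (1 - cdot (sval z) (sval w)) alpha.
by field; rewrite p0 q0.
Qed.

(** As [K = Kb * K (b, b)], the domination of kernels that gives the bound is the
    product of the hypothesis with the positive kernel [K (b, b)]. *)
Lemma weighted_composition_le (f : X -> C) (c : R) : 0 <= c ->
  psd (fun z w => (c ^+ 2)%:C%C * Kb z w - f z * (f w)^*%C) ->
  forall s, knorm K (twist f b s) <= c * knorm K s.
Proof.
move=> c0 fpsd; apply: twist_bounded => //.
have KKpsd : psd (fun z w => K (b z) (b w)).
  by apply: eq_psd (psd_twist (fun=> 1) b Kpsd) => z w; rewrite conjc1 !mul1r.
apply: eq_psd (psdM fpsd KKpsd) => z w.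
by rewrite [K z w]kernel_alpha_factor; ring.
Qed.

(** By the Cauchy-Schwarz inequality in [Hb], the rank one kernel of [f] is
    dominated by [|f|^2 Kb]. *)
Lemma weighted_composition_hnorm (Hb : hilbert_fun_space (R := R) X) f :
  reproducing_kernel Hb Kb -> carrier Hb f ->
  forall s, knorm K (twist f b s) <= hnorm Hb f * knorm K s.
Proof.
move=> hHb Hf; apply: weighted_composition_le; first exact: hnorm_ge0.
move=> s; pose v := ip Hb f (lincomb (fun w z => Kb z w) s).
have -> : form (fun z w => (hnorm Hb f ^+ 2)%:C%C * Kb z w - f z * (f w)^*%C) s s =
    (hnorm Hb f ^+ 2)%:C%C * form Kb s s - (v^*)%C * (v^*)%C^*%C.
  have -> : v^*%C * v^*%C^*%C = form (fun z w => f z * (f w)^*%C) s s.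
    rewrite conjcK /v (ip_ksumr hHb)// rmorph_sum /form mulr_suml.
    apply: eq_bigr => x _; rewrite mulr_sumr; apply: eq_bigr => y _ /=.
    by rewrite rmorphM /= conjcK; ring.
  by rewrite -formZ -mulN1r -formZ -formD; apply: eq_form => z w; rewrite mulN1r.
rewrite mul_conjE normcJE form_knorm// -rmorphM -rmorphB ler0c subr_ge0 -exprMn.
rewrite ler_pXn2r ?nnegrE ?normc_ge0 ?mulr_ge0 ?hnorm_ge0 ?knorm_ge0//.
rewrite -(hnorm_ksum hHb) normc_ip_le//; apply: carrier_lincomb.
exact: carrier_kernel.
Qed.

(** The map [b] is a row contraction: [(1 - <b z, b w>) K z w] is the product of
    [Kb] and of [(1 - <b z, b w>) ^ (1 - alpha)], whose exponent is nonpositive. *)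
Lemma psd_row_contraction : psd (fun z w => (1 - bb z w) * K z w).
Proof.
have bbpsd : psd bb.
  have bbE (z w : X) : \sum_(i < n) (sval (b z) ord0 i * (sval (b w) ord0 i)^*%C) =
    bb z w by [].
  apply: eq_psd bbE _; apply: (psd_sum (index_enum 'I_n)) => i.
  exact: (psd_rank1 (fun z : X => sval (b z) ord0 i)).
have a0 : 0 <= alpha - 1 by rewrite subr_ge0.
have := semiring_negative_power (psd_semiring R X) (u := fun p => bb p.1 p.2)
  bbpsd (fun p => normc_cdot_lt1 (b p.1) (b p.2)) a0.
move=> /(psdM Kbpsd); apply: eq_psd => z w /=.
rewrite kernel_bE /kernel_alpha mulrAC -CpowD.
have -> : alpha + - (alpha - 1) = 1 by ring.
rewrite Cpow1; last first.
  exact/Re_gt0_neq0/Re_1Bcdot_gt0.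
by rewrite mul1r.
Qed.

Let phi (z : X) : C := cdot (sval (b z)) a.

(** With [r = |a|], the kernel [(r^2 - phi z * conj (phi w)) K z w] is the sum of
    [r^2 (1 - <b z, b w>) K z w] and of the product of [K] with a Lagrange
    kernel. *)
Lemma phi_multiplier s : knorm K (twist phi id s) <= enorm a * knorm K s.
Proof.
apply: twist_bounded; [exact: Kpsd | exact: enorm_ge0 |].
have lagrange : psd (fun z w => (enorm a ^+ 2)%:C%C * bb z w - phi z * (phi w)^*%C).
  apply: eq_psd (psd_twist (fun=> 1) (fun z => sval (b z)) (psd_lagrange a)) => z w.
  by rewrite conjc1 !mul1r /phi -cdot_conj.
have r0 : 0 <= (enorm a ^+ 2)%:C%C :> C by rewrite ler0c sqr_ge0.
apply: eq_psd (psdD (psdZ r0 psd_row_contraction) (psdM lagrange Kpsd)) => z w.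
by ring.
Qed.

(** The function [f = (1 - phi) ^ alpha] is the kernel function of [Kb] at the
    origin, with squared norm [(1 - r^2) ^ alpha]. Writing [1] as the product of
    [f] and [(1 - phi) ^ (- alpha)] bounds the composition operator by the product
    of [(1 - r^2) ^ (alpha / 2)] and [(1 - r) ^ (- alpha)]. *)
Lemma composition_le s : knorm K (twist (fun=> 1) b s) <=
  ((1 + enorm a) / (1 - enorm a)) `^ (alpha / 2) * knorm K s.
Proof.
set r := enorm a; have r0 : 0 <= r := enorm_ge0 _.
have r1 : r < 1 := proj2_sig (b ball_origin).
have d0 : 0 < 1 - r by rewrite subr_gt0.
have s0 : 0 < 1 + r by rewrite ltr_wpDr.
pose c : R := (1 - r ^+ 2) `^ (alpha / 2).
pose f z := Cpow (1 - phi z) alpha.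
have r2 : 0 < 1 - r ^+ 2 by rewrite subr_gt0 expr_lt1.
have fE z : Kb z ball_origin = f z.
  rewrite kernel_bE /= cdotx0 subr0 -[X in _ / Cpow X _](rmorph1 (real_complex R)).
  by rewrite Cpow_real// powR1 rmorph1 divr1.
have f0 : f ball_origin = (c ^+ 2)%:C%C.
  rewrite /f /phi cdotxx -/a -/r.
  have -> : (1 - (r ^+ 2)%:C%C : C) = (1 - r ^+ 2)%:C%C by rewrite rmorphB rmorph1.
  rewrite Cpow_real// /c [X in _ = X%:C%C]expr2 -powRD; last by rewrite (gt_eqF r2) implybT.
  by rewrite -splitr.
have fpsd : psd (fun z w => (c ^+ 2)%:C%C * Kb z w - f z * (f w)^*%C).
  have c2 : 0 <= (c ^+ 2)%:C%C :> C by rewrite ler0c sqr_ge0.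
  apply: eq_psd (psdZ c2 (psd_schur_complement ball_origin Kbpsd)) => z w.
  rewrite /schur_complement (psd_conj w ball_origin Kbpsd) !fE f0.
  have c20 : (c ^+ 2)%:C%C != 0 :> C.
    by rewrite fmorph_eq0 expf_eq0/= gt_eqF// powR_gt0.
  by rewrite mulrBr mulrCA mulfV// mulr1.
have inv_f s' : knorm K (twist (fun z => Cpow (1 - phi z) (- alpha)) id s') <=
    (1 - r) `^ (- alpha) * knorm K s'.
  apply: multiplier_negative_power => //; first by rewrite r0 r1.
  - exact: le_trans ler01 alpha1.
  - by move=> z; exact: normc_cdot_lt1.
  - exact: phi_multiplier.
have -> : twist (fun=> 1) b s =
    twist f b (twist (fun z => Cpow (1 - phi z) (- alpha)) id s).
  rewrite /twist -map_comp; apply: eq_map => x /=; congr (_, _).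
  rewrite -[LHS]/(x.1 * (1^*)%C).
  have <- : ((Cpow (1 - phi x.2) (- alpha) * f x.2)^*)%C = (1^*)%C.
    by rewrite mulrC /f -CpowD subrr Cpow0.
  by rewrite rmorphM mulrA.
apply: le_trans (weighted_composition_le (powR_ge0 _ _) fpsd _) _.
apply: le_trans (ler_wpM2l (powR_ge0 _ _) (inv_f s)) _.
rewrite mulrA ler_wpM2r ?knorm_ge0// /c.
have -> : 1 - r ^+ 2 = (1 + r) * (1 - r) by ring.
have i0 : 0 <= (1 - r)^-1 by rewrite invr_ge0 ltW.
rewrite (powRM _ (ltW s0) (ltW d0)) (powRM _ (ltW s0) i0) -mulrA -powRD; last first.
  by rewrite (gt_eqF d0) implybT.
rewrite -(powR_inv1 (ltW d0)) -powRrM.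
by have -> : alpha / 2 + - alpha = -1 * (alpha / 2) by field.
Qed.

End CompositionOnBall.

Theorem theorem0p5 (R : realType) (n : nat) (b : Ball R n -> Ball R n)
    (alpha : R) (H : hilbert_fun_space (R := R) (Ball R n))
    (hb : holomorphic_ball b) (halpha : 1 <= alpha)
    (hH : reproducing_kernel H (kernel_alpha alpha))
    (hpsd : psd_kernel (kernel_b b alpha)) :
  (forall Hb : hilbert_fun_space (R := R) (Ball R n),
     reproducing_kernel Hb (kernel_b b alpha) ->
     forall f : Ball R n -> R[i], carrier Hb f ->
       bounded_op H (fun g => mul_op f (comp_op b g)) /\
       opnorm H (fun g => mul_op f (comp_op b g)) <= hnorm Hb f) /\
  (bounded_op H (comp_op b) /\
   opnorm H (comp_op b) <=
     ((1 + enorm (sval (b ball_origin))) / (1 - enorm (sval (b ball_origin))))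
       `^ (alpha / 2)).
Proof.
have Kpsd := reproducing_psd hH; have Kbpsd := psd_kernel_psd hpsd.
split=> [Hb hHb f Hf|].
  apply: (weighted_composition_bounded hH); first exact: hnorm_ge0.
  exact: weighted_composition_hnorm.
have -> : comp_op b = fun g => mul_op (fun=> 1) (comp_op (R := R) b g).
  by apply/funext => g; apply/funext => z; rewrite /mul_op mul1r.
apply: (weighted_composition_bounded hH); first exact: powR_ge0.
exact: composition_le.
Qed.
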